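(* Let $n\ge 1$ and let $G$ be a connected graph of order $n$. The largest eigenvalue of the distance signless Laplacian $D^Q(G)$ is maximal among all connected graphs of order $n$ (that is, $\lambda(D^Q(G))\ge\lambda(D^Q(H))$ for every connected graph $H$ of order $n$) if and only if $G$ is a path.
   Context: Graphs are finite, simple and undirected. For a connected graph $G$ of order $n$ with vertex set $[n]=\{1,\ldots,n\}$, $D(G)$ is the distance matrix of $G$, i.e. the $n\times n$ matrix whose $(i,j)$ entry is the distance $d_G(i,j)$ between vertices $i$ and $j$ in $G$, and $T(G)$ is the diagonal matrix of the row sums of $D(G)$. The distance signless Laplacian of $G$ is $D^Q(G)=T(G)+D(G)$. For a real symmetric matrix $A$, $\lambda(A)$ denotes its largest eigenvalue. ''$G$ is a path'' means $G$ is isomorphic to the path graph $P_n$ of order $n$. *)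

(* Defs.v *)
From HB Require Import structures.
From mathcomp Require Import all_boot all_order all_algebra.
From mathcomp Require Import classical_sets reals.
Set Implicit Arguments.
Unset Strict Implicit.
Unset Printing Implicit Defensive.
Import Order.TTheory GRing.Theory Num.Theory.
Local Open Scope ring_scope.

Record sgraph (n : nat) := SGraph {
  adj :> rel 'I_n;
  adj_sym : symmetric adj;
  adj_irrefl : irreflexive adj
}.

Definition connected_graph n (G : sgraph n) : Prop :=
  forall x y : 'I_n, connect G x y.

Definition has_path n (G : sgraph n) (k : nat) (x y : 'I_n) : bool :=
  [exists p : k.-tuple 'I_n,
     [&& path G x p, uniq (x :: p) & last x p == y]].

(* Length of a shortest path from x to y. A path has no repeated vertex, so
   its length is less than n; the value n is the default when there is none,
   which does not happen in a connected graph. *)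
Definition dist n (G : sgraph n) (x y : 'I_n) : nat :=
  \big[minn/n]_(k < n | has_path G k x y) k.

Definition dist_mx (R : realType) n (G : sgraph n) : 'M[R]_n :=
  \matrix_(i, j) (dist G i j)%:R.

Definition transmission_mx (R : realType) n (G : sgraph n) : 'M[R]_n :=
  diag_mx (\row_i \sum_j dist_mx R G i j).

Definition dist_signless_laplacian (R : realType) n (G : sgraph n) : 'M[R]_n :=
  transmission_mx R G + dist_mx R G.

(* A symmetric real matrix of positive order has a finite nonempty set of
   eigenvalues, so this supremum is attained and is the largest one. *)
Definition largest_eigenvalue (R : realType) n (A : 'M[R]_n) : R :=
  sup [set a : R | eigenvalue A a]%classic.

Definition path_adj n : rel 'I_n :=
  fun i j => (i.+1 == j :> nat) || (j.+1 == i :> nat).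

Lemma path_adj_sym n : symmetric (@path_adj n).
Proof. by move=> i j; rewrite /path_adj orbC. Qed.

Lemma path_adj_irrefl n : irreflexive (@path_adj n).
Proof. by move=> i; rewrite /path_adj orbb gtn_eqF. Qed.

Definition path_graph n : sgraph n :=
  SGraph (@path_adj_sym n) (@path_adj_irrefl n).

Definition isomorphic n (G H : sgraph n) : Prop :=
  exists2 f : 'I_n -> 'I_n, bijective f & forall x y, H (f x) (f y) = G x y.

Definition is_path n (G : sgraph n) : Prop := isomorphic G (path_graph n).

(* Main.v *)
Require Import Defs.
From HB Require Import structures.
From mathcomp Require Import all_boot all_order all_algebra.
From mathcomp Require Import ring lra zify.
From mathcomp Require Import classical_sets reals.
From mathcomp Require boolp topology normedtype derive.
Set Implicit Arguments.
Unset Strict Implicit.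
Unset Printing Implicit Defensive.
Import Order.TTheory GRing.Theory Num.Theory.
Local Open Scope ring_scope.

(** Write $d_G$ for the distance in $G$. The quadratic form of the distance
signless Laplacian is
  $u \mapsto \frac12 \sum_{i,j} (u_i + u_j)^2 d_G(i, j)$ [quad_laplacian],
so its largest eigenvalue is a maximum of a nonnegative combination of
distances.

The combinatorial heart is [arrangement]: for all nonnegative weights $w$ the
vertices of a connected graph can be placed on the points $0, \ldots, n-1$ of a
line so that
  $\sum_{i,j} w_{ij} d_G(i, j) \le \sum_{i,j} w_{ij} |f(i) - f(j)|$.
The vertices are inserted one at a time, each one adjacent to a vertex $u$
already placed. If the placed vertices occupy $0, \ldots, m$ and $u$ is at $s$,
a new vertex put at the left end with probability $(m-s)/m$ and at the right end
with probability $s/m$ has expected distance at least $1 + |s - y|$ to the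
vertex at $y$ [average_of_ends], that is, at least one more than the distance
from $u$. Hence one of the two ends is good enough for the given weights.

With $w_{ij} = (u_i + u_j)^2$ and $u$ a top eigenvector of $H$, this bounds the
largest eigenvalue of any connected $H$ by that of a path
[largest_eigenvalue_le_path]. For the converse, a top eigenvector $u$ of $G$ can
be taken positive [perron_vector], so the weights
$w_{ij} = (u_i + u_j)^2 - \varepsilon [ij \in E(G)]$ are still nonnegative for
some $\varepsilon > 0$. If $G$ reaches the value of the path, the arrangement
for these weights cannot stretch any edge of $G$, so it embeds $G$ in a path
[path_of_maximal], and a connected spanning subgraph of a path is the whole path
[path_of_embedding]. *)

(** * Quadratic forms and the largest eigenvalue of a symmetric matrix *)

Definition dotp (R : realType) n (u v : 'rV[R]_n) : R :=
  \sum_i u 0 i * v 0 i.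

Definition sqnorm (R : realType) n (u : 'rV[R]_n) : R := dotp u u.

Definition quad (R : realType) n (A : 'M[R]_n) (u : 'rV[R]_n) : R :=
  dotp (u *m A) u.

Section Dotp.
Variables (R : realType) (n : nat).
Implicit Types (u v w : 'rV[R]_n) (a : R) (A : 'M[R]_n).

Lemma dotpC u v : dotp u v = dotp v u.
Proof. by apply: eq_bigr => i _; rewrite mulrC. Qed.

Lemma dotpDl u v w : dotp (u + v) w = dotp u w + dotp v w.
Proof. by rewrite -big_split; apply: eq_bigr => i _; rewrite mxE mulrDl. Qed.

Lemma dotpZl a u v : dotp (a *: u) v = a * dotp u v.
Proof. by rewrite mulr_sumr; apply: eq_bigr => i _; rewrite mxE mulrA. Qed.

Lemma dotpDr u v w : dotp w (u + v) = dotp w u + dotp w v.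
Proof. by rewrite !(dotpC w) dotpDl. Qed.

Lemma dotpZr a u v : dotp u (a *: v) = a * dotp u v.
Proof. by rewrite !(dotpC u) dotpZl. Qed.

Lemma sqnorm_ge0 u : 0 <= sqnorm u.
Proof. by apply: sumr_ge0 => i _; rewrite -expr2 sqr_ge0. Qed.

Lemma sqnorm_eq0 u : (sqnorm u == 0) = (u == 0).
Proof.
rewrite psumr_eq0 => [|i _]; last by rewrite -expr2 sqr_ge0.
apply/allP/eqP => [u0|-> i _]; last by rewrite mxE mul0r eqxx.
apply/rowP => i; rewrite mxE.
by have /= := u0 i (mem_index_enum _); rewrite mulf_eq0 orbb => /eqP.
Qed.

Lemma sqnorm_gt0 u : u != 0 -> 0 < sqnorm u.
Proof. by move=> u0; rewrite lt_def sqnorm_eq0 u0 sqnorm_ge0. Qed.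

Lemma dotp_mulmx_sym A u v : A^T = A -> dotp (u *m A) v = dotp (v *m A) u.
Proof.
move=> symA; have dotpE x y : dotp x y = (x *m y^T) 0 0.
  by rewrite mxE; apply: eq_bigr => i _; rewrite mxE.
by rewrite (dotpC (v *m A)) !dotpE trmx_mul symA mulmxA.
Qed.

Lemma quad_addZ A t u v : A^T = A ->
  quad A (u + t *: v) = quad A u + 2 * t * dotp (u *m A) v + t ^+ 2 * quad A v.
Proof.
move=> symA; rewrite /quad mulmxDl -scalemxAl !(dotpDl, dotpDr, dotpZl, dotpZr).
by rewrite (dotp_mulmx_sym v u symA); ring.
Qed.

Lemma sqnorm_addZ t u v :
  sqnorm (u + t *: v) = sqnorm u + 2 * t * dotp u v + t ^+ 2 * sqnorm v.
Proof.
by rewrite /sqnorm !(dotpDl, dotpDr, dotpZl, dotpZr) (dotpC v u); ring.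
Qed.

Lemma quadE A u : quad A u = \sum_i \sum_j A j i * u 0 j * u 0 i.
Proof.
by apply: eq_bigr => i _; rewrite mxE mulr_suml; apply: eq_bigr => j _; ring.
Qed.

Lemma eigenvector_quad A a u : u *m A = a *: u -> quad A u = a * sqnorm u.
Proof. by rewrite /quad => ->; rewrite dotpZl. Qed.

End Dotp.

Section Compactness.
Import boolp topology normedtype derive numFieldNormedType.Exports.
Local Open Scope classical_set_scope.
Local Open Scope ring_scope.

Lemma continuous_quad (R : realType) n (A : 'M[R]_n) : continuous (quad A).
Proof.
have sumC (f : 'I_n -> 'rV[R]_n -> R) : (forall i, continuous (f i)) ->
    continuous (fun u => \sum_i f i u).
  by move=> fC; apply: continuous_big => //; exact: add_continuous.
rewrite (funext (quadE A)).
have coordC i : continuous (fun u : 'rV[R]_n => u 0 i).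
  exact: coord_continuous.
apply: (sumC) => i; apply: sumC => j u.
have AjC : {for u, continuous (fun v : 'rV[R]_n => A j i * v 0 j)}.
  exact: continuousM (@cst_continuous _ _ (A j i) u) (coordC j u).
exact: continuousM AjC (coordC i u).
Qed.

(** The sphere is a closed subset of the compact cube $[-1, 1]^n$. *)
Lemma quad_max_on_sphere (R : realType) n (A : 'M[R]_n) : (0 < n)%N ->
  exists2 c : 'rV[R]_n, sqnorm c = 1 &
    forall u, sqnorm u = 1 -> quad A u <= quad A c.
Proof.
case: n A => // n A _.
have sqnormE u : sqnorm u = quad (1%:M : 'M[R]_n.+1) u.
  by rewrite /quad mulmx1.
pose S := [set u : 'rV[R]_n.+1 | sqnorm u = 1].
have S0 : S !=set0.
  exists (delta_mx 0 0); rewrite /S /= /sqnorm /dotp.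
  rewrite (bigD1 ord0) //= big1 => [|i /negPf i0]; rewrite !mxE /= ?i0.
    by rewrite mulr1 addr0.
  by rewrite mul0r.
have compS : compact S.
  have boxC : compact [set v : 'rV[R]_n.+1 | forall i, v ord0 i \in `[-1, 1]].
    refine (@rV_compact R n.+1 (fun=> `[-1, 1]%classic) _) => _.
    exact: segment_compact.
  apply: (subclosed_compact _ boxC).
  - rewrite (_ : S = quad (1%:M : 'M[R]_n.+1) @^-1` [set 1]).
      apply: closed_comp; last exact: closed_eq.
      by move=> u _; exact: continuous_quad.
    by apply/seteqP; split => u; rewrite /S /= sqnormE.
  - move=> u /= u1 i; rewrite in_itv /= -ler_norml.
    rewrite -(@ler_pXn2r _ 2) ?nnegrE // expr1n real_normK ?num_real //.
    rewrite -u1 /sqnorm /dotp (bigD1 i) //= expr2 lerDl sumr_ge0 // => j _.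
    by rewrite -expr2 sqr_ge0.
have [|c] := EVT_max_rV S0 compS (f := quad A).
  by apply: continuous_subspaceT; exact: continuous_quad.
rewrite inE => c1 cmax; exists c => // u u1; apply: cmax.
by rewrite inE.
Qed.

End Compactness.

Lemma quad_max (R : realType) n (A : 'M[R]_n) : (0 < n)%N ->
  exists2 c : 'rV[R]_n, sqnorm c = 1 &
    forall u, quad A u <= quad A c * sqnorm u.
Proof.
move=> n_gt0; have [c c1 cmax] := quad_max_on_sphere A n_gt0.
exists c => // u; have [->|u0] := eqVneq u 0.
  by rewrite /quad /sqnorm -(scale0r (0 : 'rV[R]_n)) !dotpZr !mul0r mulr0.
have N0 := sqnorm_gt0 u0; pose s := (Num.sqrt (sqnorm u))^-1.
have s2 : s * s * sqnorm u = 1.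
  by rewrite -invfM -expr2 sqr_sqrtr ?ltW // mulVf ?gt_eqF.
have := cmax (s *: u); rewrite /quad /sqnorm -scalemxAl !dotpZl !dotpZr.
rewrite !mulrA => /(_ s2) le_c; rewrite -ler_pdivrMr //.
rewrite (_ : (sqnorm u)^-1 = s * s) 1?mulrC //.
by apply: (mulIf (lt0r_neq0 N0)); rewrite s2 mulVf ?lt0r_neq0.
Qed.

(** First variation: with $g = cA - ac$, moving from $c$ to $c + tg$ changes
quad A - a sqnorm by $2t |g|^2 + O(t^2)$, which cannot be positive for small
$t > 0$. *)
Lemma quad_max_eigenvector (R : realType) n (A : 'M[R]_n) a (c : 'rV[R]_n) :
    A^T = A -> (forall u, quad A u <= a * sqnorm u) ->
    quad A c = a * sqnorm c ->
  c *m A = a *: c.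
Proof.
move=> symA ub cmax; apply/eqP; rewrite -subr_eq0 -scaleNr; set g := _ + _.
rewrite -sqnorm_eq0 eq_le sqnorm_ge0 andbT leNgt; apply/negP => G0.
pose K := a * sqnorm g - quad A g.
have K0 : 0 <= K by rewrite subr_ge0.
(* K is minus the coefficient of t ^+ 2; adding 1 makes t well defined when K
   vanishes, and t * K < sqnorm g. *)
have K1 : 0 < K + 1 by rewrite ltr_wpDl.
pose t := sqnorm g / (K + 1).
have t0 : 0 < t by rewrite divr_gt0.
have key : 2 * t * sqnorm g <= t * t * K.
  have gE : sqnorm g = dotp (c *m A) g - a * dotp c g.
    by rewrite {1}/sqnorm {1}/g dotpDl dotpZl mulNr.
  have := ub (c + t *: g).
  rewrite quad_addZ // sqnorm_addZ cmax -[K]/(_ - _).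
  move: (quad A g) (sqnorm c) gE => x y ->; clear; nra.
have tK : t * (K + 1) = sqnorm g by rewrite /t divfK ?lt0r_neq0.
clear - key tK t0 G0; nra.
Qed.

(** The supremum of the eigenvalues is the maximum of the Rayleigh quotient: a
maximizer is an eigenvector, and any eigenvector bounds its eigenvalue by that
maximum. *)
Lemma largest_eigenvalueP (R : realType) n (A : 'M[R]_n) :
    (0 < n)%N -> A^T = A ->
  (forall u, quad A u <= largest_eigenvalue A * sqnorm u) /\
  exists2 c, c != 0 & quad A c = largest_eigenvalue A * sqnorm c.
Proof.
move=> n_gt0 symA; have [c c1 cmax] := quad_max A n_gt0.
have c0 : c != 0 by rewrite -sqnorm_eq0 c1 oner_eq0.
suff -> : largest_eigenvalue A = quad A c.
  by split=> //; exists c => //; rewrite c1 mulr1.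
have cA : eigenvalue A (quad A c).
  apply/eigenvalueP; exists c => //; apply: quad_max_eigenvector => //.
  by rewrite c1 mulr1.
have ubA : ubound [set a : R | eigenvalue A a]%classic (quad A c).
  move=> a /eigenvalueP[u uA u0]; have := cmax u.
  by rewrite (eigenvector_quad uA) ler_pM2r // sqnorm_gt0.
apply/eqP; rewrite eq_le ge_sup //=; last by exists (quad A c).
by apply: ub_le_sup => //; exists (quad A c).
Qed.

(** * Distances in a graph *)

Section Distance.
Variables (n : nat) (G : sgraph n).
Implicit Types (x y z : 'I_n) (p : seq 'I_n).

Lemma dist_le_path x p : path G x p -> (dist G x (last x p) <= size p)%N.
Proof.
case/shortenP => q Gq Uq sub_qp.
have q_lt : (size q < n)%N.
  by have := max_card (mem (x :: q)); rewrite (card_uniqP Uq) card_ord.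
apply: (@leq_trans (size q)); last first.
  by apply: uniq_leq_size => //; case/andP: Uq.
rewrite /dist -minEnat; apply: (bigmin_le_cond n _ (j := Ordinal q_lt)).
by apply/existsP; exists (in_tuple q); rewrite /= Gq eqxx andbT.
Qed.

(** The bound m <= n accounts for the default value n of the distance. *)
Lemma dist_ge_path m x y : (m <= n)%N ->
  (forall p, path G x p -> last x p = y -> (m <= size p)%N) ->
  (m <= dist G x y)%N.
Proof.
move=> le_mn le_mp; rewrite /dist; elim/big_ind: _ => // [a b ma mb|k].
  by rewrite leq_min ma.
by case/existsP => p /and3P[Gp _ /eqP yE]; rewrite -(size_tuple p) le_mp.
Qed.

Lemma geodesic x y : connect G x y ->
  exists p, [/\ path G x p, last x p = y & size p = dist G x y].
Proof.
case/connectP => q Gq yE.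
have [p [Gp pE le_p]] : exists p,
    [/\ path G x p, last x p = y & (size p <= dist G x y)%N].
  rewrite /dist; elim/big_ind: _ => [|a b|].
  - rewrite yE; case/shortenP: Gq => p Gp Up _; exists p; split=> //.
    by have := max_card (mem (x :: p)); rewrite (card_uniqP Up) card_ord => /ltnW.
  - by rewrite /minn; case: ifP => _ ? ?.
  - move=> k /existsP[p /and3P[Gp _ /eqP pE]]; exists p.
    by rewrite size_tuple.
exists p; split=> //; apply/eqP; rewrite eqn_leq le_p -pE.
exact: dist_le_path.
Qed.

Lemma distxx x : dist G x x = 0%N.
Proof. by apply/eqP; rewrite -leqn0; exact: (@dist_le_path x [::]). Qed.

Lemma dist_gt0 x y : x != y -> (0 < dist G x y)%N.
Proof.
move=> xy; have n_gt0 : (0 < n)%N := leq_ltn_trans (leq0n x) (ltn_ord x).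
apply: dist_ge_path => // -[|//] _ /= xyE.
by rewrite xyE eqxx in xy.
Qed.

(** Each step of a walk in G moves the image under f by one place. *)
Lemma lipschitz_dist (f : 'I_n -> 'I_n) :
  (forall x y, G x y -> path_graph n (f x) (f y)) ->
  forall x y, (`|f x - f y| <= dist G x y)%N.
Proof.
move=> fG x y; apply: dist_ge_path.
  have := ltn_ord (f x); have := ltn_ord (f y); lia.
move=> p; elim: p x => [x _ /= ->|z p IHp x /= /andP[/fG xz Gp] pE].
  by rewrite distnn.
by have := IHp z Gp pE; move: xz; rewrite /= /path_adj; lia.
Qed.

Hypothesis G_conn : connected_graph G.

Lemma dist_adj x y z : G x y -> (dist G x z <= (dist G y z).+1)%N.
Proof.
move=> Gxy; have [p [Gp <- <-]] := geodesic (G_conn y z).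
by apply: (@dist_le_path x (y :: p)); rewrite /= Gxy.
Qed.

Lemma dist_sym x y : dist G x y = dist G y x.
Proof.
suff le_xy a b : (dist G a b <= dist G b a)%N by apply/eqP; rewrite eqn_leq !le_xy.
have [p [Gp <- <-]] := geodesic (G_conn b a).
have Gq : path G (last b p) (rev (belast b p)).
  by rewrite rev_path (eq_path (e' := G)) // => u v /=; rewrite adj_sym.
have := dist_le_path Gq; rewrite size_rev size_belast.
by case: p {Gp Gq} => // c p; rewrite /= rev_cons last_rcons.
Qed.

End Distance.

Lemma path_graph_connected n : connected_graph (path_graph n).
Proof.
move=> x y; wlog le_xy : x y / (x <= y)%N.
  move=> W; case/orP: (leq_total x y) => [|le_yx]; first exact: W.
  by rewrite (sym_connect_sym (@adj_sym _ (path_graph n))) W.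
have [k yE] : exists k, (y : nat) = (x + k)%N by exists (y - x)%N; rewrite subnKC.
elim: k y yE {le_xy} => [|k IHk] y yE.
  by rewrite (_ : y = x) ?connect0 //; apply: val_inj; rewrite /= yE addn0.
have lt_n : (x + k < n)%N by rewrite (leq_trans _ (ltn_ord y)) // yE addnS.
apply: (connect_trans (IHk (Ordinal lt_n) erefl)).
by apply: connect1; rewrite /= /path_adj /= yE addnS eqxx.
Qed.

(** * Arranging the vertices of a connected graph on a line *)

Definition pair_sum (R : realType) (V : finType) (S : {set V})
    (w : V -> V -> R) (d : V -> V -> nat) : R :=
  \sum_(i in S) \sum_(j in S) w i j * (d i j)%:R.

Lemma pair_sumU1 (R : realType) (V : finType) (S : {set V}) l
    (w : V -> V -> R) (d : V -> V -> nat) :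
    l \notin S -> d l l = 0%N -> (forall j, d j l = d l j) ->
  pair_sum (l |: S) w d
    = pair_sum S w d + \sum_(j in S) (w l j + w j l) * (d l j)%:R.
Proof.
move=> lS dll dsym; rewrite /pair_sum big_setU1 //= big_setU1 //= dll mulr0 add0r.
under [X in _ + X]eq_bigr do rewrite big_setU1 //=.
rewrite big_split /= addrA -big_split /= addrC; congr (_ + _).
by apply: eq_bigr => j _; rewrite dsym mulrDl.
Qed.

(** A new point put at the left end of $0, \ldots, m$ is at distance $y + 1$ from
$y$, and at the right end at distance $m + 1 - y$. The right-hand side is thus
$m$ times the mean distance for the probabilities $(m-s)/m$ and $s/m$. It is
affine in $y$, the left-hand side is convex in $y$, and the two agree at $y = 0$
and at $y = m$. *)
Lemma average_of_ends (m s y : nat) : (s <= m)%N -> (y <= m)%N ->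
  (m * `|s - y|.+1 <= (m - s) * y.+1 + s * (m.+1 - y))%N.
Proof.
move=> sm ym; case: (leqP s y) => sy.
  have [[a yE] [b mE]] : (exists a, y = s + a)%N /\ (exists b, m = y + b)%N.
    by split; [exists (y - s)%N|exists (m - y)%N]; rewrite subnKC.
  by subst; nia.
have [[a sE] [b mE]] : (exists a, s = y + a)%N /\ (exists b, m = s + b)%N.
  by split; [exists (s - y)%N|exists (m - s)%N]; rewrite subnKC // ltnW.
by subst; nia.
Qed.

Lemma boundary_edge n (G : sgraph n) (S : {set 'I_n}) x y :
  connected_graph G -> x \in S -> y \notin S ->
  exists u l, [/\ u \in S, l \notin S & G l u].
Proof.
move=> G_conn xS yS.
have [/existsP[u /existsP[l /and3P[]]]|/negP noedge] :=
  boolP [exists u, exists l, [&& u \in S, l \notin S & G l u]].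
  by exists u, l.
have /closed_connect clS : closed G (mem S).
  apply: intro_closed => [|u l Gul uS]; first exact/sym_connect_sym/adj_sym.
  apply/negPn/negP => lS; case: noedge.
  by apply/existsP; exists u; apply/existsP; exists l; rewrite uS lS adj_sym.
by move: yS; rewrite -(clS x y (G_conn x y)) xS.
Qed.

Section Arrangement.
Variables (R : realType) (n : nat) (G : sgraph n).
Hypothesis G_conn : connected_graph G.

(** The quantification over all weights is what lets the induction on S change
them when a vertex is added. *)
Definition arrangeable (S : {set 'I_n}) :=
  forall w : 'I_n -> 'I_n -> R, (forall i j, 0 <= w i j) ->
  exists s : 'I_n -> nat, [/\ {in S &, injective s},
    forall i, i \in S -> (s i < #|S|)%N
    & pair_sum S w (dist G) <= pair_sum S w (fun i j => `|s i - s j|%N)].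

Lemma arrangeable1 x : arrangeable [set x].
Proof.
move=> w w_ge0; exists (fun=> 0%N); split=> [i j||].
- by rewrite !inE => /eqP-> /eqP->.
- by move=> i _; rewrite cards1.
by rewrite /pair_sum !big_set1 distxx distnn.
Qed.

(** Since $d_G(l, j) \le 1 + d_G(u, j)$, the total weight $c_j$ of the pair
$\{l, j\}$ can be moved to $\{u, j\}$; the arrangement of S for these new weights
is then extended by l at the better of the two ends. *)
Lemma arrangeableU1 (S : {set 'I_n}) u l : u \in S -> l \notin S -> G l u ->
  arrangeable S -> arrangeable (l |: S).
Proof.
move=> uS lS Glu arrS w w_ge0; pose c j := w l j + w j l.
have c_ge0 j : 0 <= c j by rewrite addr_ge0.
pose w' i j := w i j + (i == u)%:R * c j.
have w'E d : pair_sum S w' d = pair_sum S w d + \sum_(j in S) c j * (d u j)%:R.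
  transitivity (pair_sum S w d
      + \sum_(i in S) (i == u)%:R * \sum_(j in S) c j * (d i j)%:R).
    rewrite -big_split; apply: eq_bigr => i _; rewrite mulr_sumr -big_split.
    by apply: eq_bigr => j _; rewrite mulrDl mulrA.
  congr (_ + _); rewrite (bigD1 u) //= eqxx mul1r.
  rewrite [X in _ + X]big1 ?addr0 //.
  by move=> i /andP[_ /negPf ->]; rewrite mul0r.
have [|s [s_inj s_lt s_ge]] := arrS w'.
  by move=> i j; rewrite addr_ge0 // mulr_ge0 // ler0n.
have [m mE] : exists m, #|S| = m.+1.
  by exists #|S|.-1; rewrite prednK //; apply/card_gt0P; exists u.
have s_le i : i \in S -> (s i <= m)%N by move=> /s_lt; rewrite mE.
have cardU : #|l |: S| = m.+2 by rewrite cardsU1 lS mE.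
pose C := pair_sum S w (fun i j => `|s i - s j|%N).
pose mid := \sum_(j in S) c j * (`|s u - s j|.+1)%:R.
pose left := \sum_(j in S) c j * (s j).+1%:R.
pose right := \sum_(j in S) c j * (m.+1 - s j)%N%:R.
have le_mid : pair_sum (l |: S) w (dist G) <= C + mid.
  rewrite pair_sumU1 ?distxx //; last by move=> j; exact: dist_sym.
  apply: (@le_trans _ _ (pair_sum S w' (dist G) + \sum_(j in S) c j)).
    rewrite w'E -addrA lerD2l -big_split; apply: ler_sum => j _ /=.
    rewrite -/(c j) -[X in _ + X]mulr1 -mulrDr ler_wpM2l // natr1 ler_nat.
    exact: dist_adj.
  rewrite (le_trans (lerD s_ge (lexx _))) // w'E -addrA lerD2l -big_split.
  by apply: ler_sum => j _ /=; rewrite -[X in _ + X]mulr1 -mulrDr natr1.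
(* Any extension of s to l that keeps the distances within S works, provided l
   is far enough from S; s itself may be shifted to make room on the left. *)
have arrange (s' : 'I_n -> nat) :
    (forall i, i \in S -> s' i != s' l) ->
    (forall i, i \in l |: S -> (s' i < m.+2)%N) ->
    {in S &, forall i j, `|s' i - s' j|%N = `|s i - s j|%N} ->
    mid <= \sum_(j in S) c j * (`|s' l - s' j|%N)%:R ->
  exists s' : 'I_n -> nat, [/\ {in l |: S &, injective s'},
    forall i, i \in l |: S -> (s' i < #|l |: S|)%N
    & pair_sum (l |: S) w (dist G)
        <= pair_sum (l |: S) w (fun i j => `|s' i - s' j|%N)].
  move=> s'_ne s'_lt s'_iso le_mid'; exists s'; split; last 1 first.
  - rewrite (le_trans le_mid) // pair_sumU1 ?distnn //; last first.
      by move=> j; rewrite distnC.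
    apply: lerD le_mid'; rewrite le_eqVlt; apply/orP; left; apply/eqP.
    by apply: eq_bigr => i iS; apply: eq_bigr => j jS; rewrite s'_iso.
  - move=> i j; rewrite !in_setU1 => /predU1P[->|iS] /predU1P[->|jS] //.
    + by move=> /esym/eqP; rewrite (negPf (s'_ne _ jS)).
    + by move=> /eqP; rewrite (negPf (s'_ne _ iS)).
    + move=> ss; apply: s_inj => //; apply/eqP; rewrite -distn_eq0.
      by rewrite -s'_iso // ss distnn.
  - by rewrite cardU.
have ne_l i : i \in S -> (i == l) = false.
  by move=> iS; apply: contraNF lS => /eqP <-.
have m_avg : m%:R * mid <= (m - s u)%N%:R * left + (s u)%:R * right.
  rewrite !mulr_sumr -big_split; apply: ler_sum => j jS /=.
  rewrite !(mulrCA _ (c j)) -mulrDr ler_wpM2l // -!natrM -natrD ler_nat.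
  by rewrite average_of_ends ?s_le.
have [le_left|lt_left] := leP mid left.
  apply: (@arrange (fun i => if i == l then 0%N else (s i).+1)).
  - by move=> i iS; rewrite eqxx ne_l.
  - move=> i; rewrite in_setU1 => /predU1P[->|iS]; rewrite ?eqxx ?ne_l //.
    by rewrite !ltnS s_le.
  - by move=> i j iS jS; rewrite !ne_l // -(addn1 (s i)) -(addn1 (s j)) distnDr.
  - rewrite eqxx; apply: (le_trans le_left); apply: ler_sum => j jS.
    by rewrite ne_l // distnC distn0.
apply: (@arrange (fun i => if i == l then m.+1 else s i)).
- by move=> i iS; rewrite eqxx ne_l // neq_ltn ltnS s_le.
- move=> i; rewrite in_setU1 => /predU1P[->|iS]; rewrite ?eqxx ?ne_l //.
  by rewrite (leq_ltn_trans (s_le i iS)).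
- by move=> i j iS jS; rewrite !ne_l.
rewrite eqxx; have -> : \sum_(j in S) c j *
    (`|m.+1 - (if j == l then m.+1 else s j)|%N)%:R = right.
  by apply: eq_bigr => j jS; rewrite ne_l // distnEl // (leq_trans (s_le j jS)).
(* If s u = 0, the averaged inequality only concerns the left end, unless m = 0,
   where the two ends coincide up to a shift. *)
have [su0|su_gt0] := posnP (s u).
  move: m_avg; rewrite su0 mul0r addr0 subn0.
  have [m0|m_gt0] := posnP m; last by rewrite ler_pM2l ?ltr0n // leNgt lt_left.
  suff : mid = left by move=> /eqP; rewrite gt_eqF.
  apply: eq_bigr => j jS; have := s_le j jS; rewrite su0 m0 leqn0 => /eqP->.
  by rewrite distnn.
rewrite leNgt; apply/negP => lt_right; move: m_avg; apply/negP; rewrite -ltNge.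
rewrite -{2}(subnK (s_le u uS)) natrD mulrDl ler_ltD //.
  by rewrite ler_wpM2l // ?ler0n // ltW.
by rewrite ltr_pM2l // ltr0n.
Qed.

Lemma arrangement (n_gt0 : (0 < n)%N) (w : 'I_n -> 'I_n -> R) :
    (forall i j, 0 <= w i j) ->
  exists2 f : 'I_n -> 'I_n, bijective f &
    \sum_i \sum_j w i j * (dist G i j)%:R
      <= \sum_i \sum_j w i j * (`|f i - f j|%N)%:R.
Proof.
move=> w_ge0; pose x0 := Ordinal n_gt0.
have grow k : (k < n)%N -> exists S : {set 'I_n}, [/\ #|S| = k.+1, x0 \in S & arrangeable S].
  elim: k => [|k IHk] k_lt.
    exists [set x0]; rewrite cards1 set11; split=> //; exact: arrangeable1.
  have [S [cardS x0S arrS]] := IHk (ltnW k_lt).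
  have /card_gt0P[y] : (0 < #|[predC S]|)%N.
    by rewrite -(ltn_add2l #|S|) cardC addn0 cardS card_ord.
  rewrite inE => yS; have [u [l [uS lS Glu]]] := boundary_edge G_conn x0S yS.
  exists (l |: S); rewrite cardsU1 lS cardS in_setU1 x0S orbT.
  by split=> //; exact: arrangeableU1 Glu arrS.
have [|S [cardS _ arrS]] := grow n.-1; first by rewrite prednK.
have inS i : i \in S.
  have /card0_eq/(_ i) : #|[predC S]| = 0%N.
    by apply/eqP; rewrite -(eqn_add2l #|S|) cardC addn0 cardS card_ord prednK.
  by rewrite !inE => /negbFE.
have pair_sumE d : pair_sum S w d = \sum_i \sum_j w i j * (d i j)%:R.
  by apply: eq_big => i //; rewrite ?inS // => _; apply: eq_bigl => j; rewrite inS.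
have [s [s_inj s_lt s_le]] := arrS w w_ge0.
have {}s_lt i : (s i < n)%N by rewrite (leq_trans (s_lt i (inS i))) // cardS prednK.
exists (fun i => Ordinal (s_lt i)); last by rewrite -!pair_sumE.
by apply: injF_bij => i j /(congr1 val) /= /s_inj; exact.
Qed.
End Arrangement.

(** * The distance signless Laplacian *)

Section SignlessLaplacian.
Variables (R : realType) (n : nat) (G : sgraph n).
Hypothesis G_conn : connected_graph G.
Local Notation L := (dist_signless_laplacian R G).
Local Notation lambda := (largest_eigenvalue L).

Lemma laplacianE i j : L i j
  = (\sum_k (dist G i k)%:R) *+ (i == j) + (dist G i j)%:R.
Proof.
rewrite !mxE; congr (_ *+ _ + _).
by apply: eq_bigr => k _; rewrite mxE.
Qed.

Lemma laplacian_sym : L^T = L.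
Proof.
apply/matrixP => i j; rewrite mxE !laplacianE (dist_sym G_conn j).
by case: eqVneq => [->|]; rewrite ?mulr0n.
Qed.

Lemma quad_laplacian u :
  2 * quad L u = \sum_i \sum_j (u 0 i + u 0 j) ^+ 2 * (dist G i j)%:R.
Proof.
pose P := \sum_i \sum_j (dist G i j)%:R * u 0 i ^+ 2.
pose Q := \sum_i \sum_j (dist G i j)%:R * (u 0 i * u 0 j).
have -> : quad L u = P + Q.
  rewrite quadE -big_split; apply: eq_bigr => i _ /=.
  under eq_bigr do rewrite laplacianE mulrDl mulrDl.
  rewrite big_split /=; congr (_ + _).
    rewrite (bigD1 i) //= eqxx mulr1n [X in _ + X]big1; last first.
      by move=> j /negPf ->; rewrite mulr0n !mul0r.
    by rewrite addr0 -mulrA -expr2 mulr_suml.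
  by apply: eq_bigr => j _; rewrite dist_sym // -mulrA (mulrC (u 0 j)).
have PE : P = \sum_i \sum_j (dist G i j)%:R * u 0 j ^+ 2.
  rewrite /P exchange_big /=; apply: eq_bigr => i _; apply: eq_bigr => j _.
  by rewrite dist_sym.
rewrite mulrDr mulr_natl mulr2n {2}PE mulr_sumr -!big_split /=.
apply: eq_bigr => i _; rewrite mulr_sumr -!big_split /=.
by apply: eq_bigr => j _; ring.
Qed.

Lemma quad_laplacian_le u : (0 < n)%N -> quad L u <= lambda * sqnorm u.
Proof. by move=> n_gt0; case: (largest_eigenvalueP n_gt0 laplacian_sym). Qed.

(** Taking absolute values of the entries preserves the norm and does not
decrease the quadratic form, so there is a nonnegative top eigenvector. If it
vanished at i, so would row i of the eigenvalue equation, a sum of nonnegative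
terms with positive off-diagonal coefficients, and the vector would be zero. *)
Lemma perron_vector : (0 < n)%N -> exists2 u : 'rV[R]_n,
  forall i, 0 < u 0 i & quad L u = lambda * sqnorm u.
Proof.
move=> n_gt0; have [ub [c c0 cE]] := largest_eigenvalueP n_gt0 laplacian_sym.
pose u : 'rV[R]_n := \row_i `|c 0 i|.
have normu : sqnorm u = sqnorm c.
  by apply: eq_bigr => i _; rewrite mxE -!expr2 real_normK ?num_real.
have uE : quad L u = lambda * sqnorm u.
  apply/eqP; rewrite eq_le ub normu -cE.
  rewrite -(@ler_pM2l _ 2) // !quad_laplacian; apply: ler_sum => i _.
  apply: ler_sum => j _; rewrite ler_wpM2r ?ler0n // !mxE.
  by rewrite -real_normK ?num_real // lerXn2r ?nnegrE ?addr_ge0 ?ler_normD.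
have u_eig := quad_max_eigenvector laplacian_sym ub uE.
have u_ge0 i : 0 <= u 0 i by rewrite mxE.
have L_ge0 i j : 0 <= L i j by rewrite laplacianE addr_ge0 ?mulrn_wge0 ?sumr_ge0.
exists u => // i; rewrite lt_def u_ge0 andbT; apply/eqP => ui0.
move: c0; rewrite -sqnorm_eq0 -normu sqnorm_eq0 => /eqP; apply.
apply/rowP => j; rewrite [RHS]mxE; have [<-//|ij] := eqVneq i j.
have : (u *m L) 0 i = 0 by rewrite u_eig mxE ui0 mulr0.
rewrite mxE => /eqP; rewrite psumr_eq0 => [|k _]; last exact: mulr_ge0.
move=> /allP/(_ j (mem_index_enum _)) /=.
rewrite mulf_eq0 laplacianE eq_sym in ij *; rewrite (negPf ij) add0r pnatr_eq0.
by rewrite eqn0Ngt dist_gt0 // orbF => /eqP.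
Qed.

(** The embedding f0 into the path shows that distances in G are at least those
along the line; the entries of u are permuted so that the places given by f and
by f0 agree. *)
Lemma path_bound (f0 f : 'I_n -> 'I_n) (u : 'rV[R]_n) :
    (0 < n)%N -> bijective f0 -> bijective f ->
    (forall x y, G x y -> path_graph n (f0 x) (f0 y)) ->
  \sum_i \sum_j (u 0 i + u 0 j) ^+ 2 * (`|f i - f j|%N)%:R
    <= 2 * (lambda * sqnorm u).
Proof.
move=> n_gt0 f0_bij [g fK gK] f0G; pose h a := g (f0 a).
have h_bij : bijective h by apply: bij_comp f0_bij; exists f.
have h_on : {on predT, bijective h} by exact: onW_bij.
pose y : 'rV[R]_n := \row_a u 0 (h a).
have -> : sqnorm u = sqnorm y.
  by rewrite /sqnorm /dotp (reindex h) //; apply: eq_bigr => a _; rewrite mxE.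
apply: le_trans (_ : 2 * quad L y <= _); last first.
  by rewrite ler_wpM2l // quad_laplacian_le.
rewrite quad_laplacian (reindex h) //; apply: ler_sum => a _.
rewrite (reindex h) //; apply: ler_sum => b _.
rewrite !mxE ler_wpM2l ?sqr_ge0 // ler_nat /h !gK.
exact: lipschitz_dist.
Qed.

End SignlessLaplacian.

(** * Paths are exactly the maximizers *)

Lemma largest_eigenvalue_le_path (R : realType) n (G H : sgraph n) :
    (0 < n)%N -> connected_graph G -> is_path G -> connected_graph H ->
  largest_eigenvalue (dist_signless_laplacian R H)
    <= largest_eigenvalue (dist_signless_laplacian R G).
Proof.
move=> n_gt0 G_conn [f0 f0_bij f0E] H_conn.
have [u u_gt0 uE] := perron_vector R H_conn n_gt0.
have [|f f_bij le_f] := @arrangement R n H H_conn n_gt0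
  (fun i j => (u 0 i + u 0 j) ^+ 2); first by move=> i j; rewrite sqr_ge0.
have u_ne0 : u != 0.
  apply/eqP => u0; have := u_gt0 (Ordinal n_gt0).
  by rewrite u0 mxE ltxx.
have := @path_bound R n G G_conn f0 f u n_gt0 f0_bij f_bij.
move=> /(_ (fun x y => etrans (f0E x y))) /(le_trans le_f).
rewrite -(quad_laplacian H_conn) uE (ler_pM2l (ltr0Sn R 1)).
by rewrite (ler_pM2r (sqnorm_gt0 u_ne0)); exact.
Qed.

(** If the path edge from f x to f y = f x + 1 were missing, no edge of G would
leave the set of vertices placed at most at f x. *)
Lemma path_of_embedding n (G : sgraph n) (f : 'I_n -> 'I_n) :
    connected_graph G -> bijective f ->
    (forall x y, G x y -> path_graph n (f x) (f y)) ->
  is_path G.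
Proof.
move=> G_conn f_bij fG; exists f => // x y; apply/idP/idP; last exact: fG.
wlog fxy : x y / (f y = (f x).+1 :> nat)%N.
  move=> W; rewrite /= {1}/path_adj => /orP[]/eqP fE.
    by apply: (W x y) => //; rewrite /= /path_adj fE eqxx.
  by rewrite adj_sym; apply: (W y x) => //; rewrite /= /path_adj fE eqxx.
move=> _; have [u [l []]] : exists u l, [/\ (f u <= f x)%N, ~~ (f l <= f x)%N & G l u].
  have := @boundary_edge n G [set a | (f a <= f x)%N]%SET x y G_conn.
  rewrite !inE fxy ltnn leqnn => /(_ isT isT)[u [l []]].
  by rewrite !inE => *; exists u, l.
rewrite -ltnNge => fu fl Glu; have := fG _ _ Glu; rewrite /= /path_adj => flu.
have [fuE flE] : (f u = f x :> nat)%N /\ (f l = f y :> nat)%N by lia.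
have f_inj := bij_inj f_bij.
by rewrite -(f_inj _ _ (val_inj fuE)) -(f_inj _ _ (val_inj flE)) adj_sym.
Qed.

(** Lowering the weight of the edges of G by e > 0 rewards arrangements that do
not stretch edges: maximality of G bounds the arranged sum for the unperturbed
weights by the one for $d_G$, so the arranged edge lengths sum to at most the
number of edges, while each of them is at least 1. *)
Lemma path_of_maximal (R : realType) n (G : sgraph n) :
    (0 < n)%N -> connected_graph G ->
    largest_eigenvalue (dist_signless_laplacian R (path_graph n))
      <= largest_eigenvalue (dist_signless_laplacian R G) ->
  is_path G.
Proof.
move=> n_gt0 G_conn G_max; have [u u_gt0 uE] := perron_vector R G_conn n_gt0.
pose w0 i j := (u 0 i + u 0 j) ^+ 2.
have [e e_gt0 e_le] : exists2 e : R, 0 < e & forall i j, e <= w0 i j.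
  pose m := \big[Num.min/1]_i u 0 i.
  have m_gt0 : 0 < m by rewrite /m; elim/big_ind: _ => // a b a0 b0; rewrite lt_min a0.
  exists (m ^+ 2) => [|i j]; first by rewrite exprn_gt0.
  have m_le : m <= u 0 i by exact: bigmin_le.
  rewrite lerXn2r ?nnegrE ?(ltW m_gt0) ?addr_ge0 ?(ltW (u_gt0 _)) //.
  by rewrite (le_trans m_le) // lerDl ltW.
pose w i j := w0 i j - e * (G i j)%:R.
have [i j|f f_bij le_f] := @arrangement R n G G_conn n_gt0 w.
  rewrite subr_ge0 (le_trans _ (e_le i j)) //.
  by case: (G i j); rewrite ?mulr1 ?mulr0 // ltW.
have splitw (d : 'I_n -> 'I_n -> nat) : \sum_i \sum_j w i j * (d i j)%:R
    = \sum_i \sum_j w0 i j * (d i j)%:R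
      - e * \sum_i \sum_j (G i j)%:R * (d i j)%:R.
  rewrite mulr_sumr -sumrB; apply: eq_bigr => i _.
  rewrite mulr_sumr -sumrB; apply: eq_bigr => j _.
  by rewrite mulrBl mulrA.
have le_w0 : \sum_i \sum_j w0 i j * (`|f i - f j|%N)%:R
    <= \sum_i \sum_j w0 i j * (dist G i j)%:R.
  rewrite -quad_laplacian // uE.
  have := @path_bound R n (path_graph n) (@path_graph_connected n) id f u n_gt0.
  move=> /(_ (inv_bij (fun=> erefl)) f_bij (fun _ _ => id)).
  move=> /le_trans; apply; rewrite (ler_pM2l (ltr0Sn R 1)).
  exact: (ler_wpM2r (sqnorm_ge0 u) G_max).
have edge_ge1 i j : G i j -> (0 < `|f i - f j|)%N.
  move=> Gij; rewrite lt0n distn_eq0; apply: contraTneq Gij => /val_inj fij.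
  by rewrite (bij_inj f_bij fij) adj_irrefl.
pose excess i j : R := (G i j)%:R * ((`|f i - f j|%N)%:R - 1).
have excess_ge0 i j : 0 <= excess i j.
  rewrite /excess; case: (boolP (G i j)) => [/edge_ge1 Gij|_].
    by rewrite mul1r subr_ge0 ler1n.
  by rewrite mul0r.
have no_excess : \sum_i \sum_j excess i j <= 0.
  rewrite !splitw in le_f.
  have le_edges : \sum_i \sum_j (G i j)%:R * (`|f i - f j|%N)%:R
      <= \sum_i \sum_j (G i j)%:R * (dist G i j)%:R :> R.
    by rewrite -(ler_pM2l e_gt0); move: le_f le_w0; clear; lra.
  apply: (@le_trans _ _ (\sum_i \sum_j (G i j)%:R * ((dist G i j)%:R - 1))).
    have shift (d : 'I_n -> 'I_n -> nat) :
        \sum_i \sum_j (G i j)%:R * ((d i j)%:R - 1)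
        = \sum_i \sum_j (G i j)%:R * (d i j)%:R
          - \sum_i \sum_j (G i j)%:R :> R.
      rewrite -sumrB; apply: eq_bigr => i _; rewrite -sumrB.
      by apply: eq_bigr => j _; rewrite mulrBr mulr1.
    by rewrite /excess !shift lerD2r.
  apply: sumr_le0 => i _; apply: sumr_le0 => j _.
  case: (boolP (G i j)) => Gij; last by rewrite mul0r.
  rewrite mul1r subr_le0 lern1 (leq_trans (dist_adj G_conn _ Gij)) //.
  by rewrite distxx.
apply: (path_of_embedding G_conn f_bij) => i j Gij.
have : \sum_i \sum_j excess i j == 0.
  by rewrite eq_le no_excess sumr_ge0 // => a _; exact: sumr_ge0.
rewrite pair_bigA psumr_eq0 //= => /allP/(_ (i, j) (mem_index_enum _)) /=.
rewrite /excess Gij mul1r subr_eq0 pnatr_eq1 /path_adj; lia.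
Qed.

Theorem mainTheorem4 (R : realType) (n : nat) (n_ge1 : (1 <= n)%N)
    (G : sgraph n) (G_conn : connected_graph G) :
  (forall H : sgraph n, connected_graph H ->
     largest_eigenvalue (dist_signless_laplacian R H)
       <= largest_eigenvalue (dist_signless_laplacian R G))
  <-> is_path G.
Proof.
split=> [G_max|G_path H]; last exact: largest_eigenvalue_le_path.
exact: path_of_maximal (G_max _ (@path_graph_connected n)).
Qed.
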